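(* Let $K$ be a field, let $\nu : K^* \to \mathbb{Z}$ be a discrete valuation on $K$, and let $R$ be the discrete valuation ring of $\nu$, i.e. $R = \{\alpha \in K : \nu(\alpha) \geq 0\}$. For each integer $n \geq 0$ put $$R_n = \{\alpha \in K : \nu(\alpha) \geq n\}.$$ Then $R$ is a strongly filtered ring with (strong) filtration $\{R_n\}_{n \geq 0}$, where $R_0 = R$.
   Context: All rings are commutative with unit. $K^* = K \setminus \{0\}$. A discrete valuation on a field $K$ is a surjective map $\nu : K^* \to \mathbb{Z}$ with $\nu(ab) = \nu(a) + \nu(b)$ and $\nu(a+b) \geq \min\{\nu(a), \nu(b)\}$ (whenever $a+b \neq 0$). By convention $\nu(0) = \infty$, where $\infty \geq n$ for all $n \in \mathbb{Z}$, so that $0 \in R_n$ for every $n$. A strong filtration on a ring $R$ is a family $\{R_n\}_{n \geq 0}$ of additive subgroups of $R$ such that: (i) $R_0 = R$; (ii) $R_{n+1} \subseteq R_n$ for all $n \geq 0$; (iii) $R_n R_m = R_{n+m}$ for all $n, m \geq 0$, where $R_n R_m$ denotes the set of finite sums $\sum_i a_i b_i$ with $a_i \in R_n$, $b_i \in R_m$. A ring together with a strong filtration is called a strongly filtered ring. *)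

(* Defs.v *)
From HB Require Import structures.
From mathcomp Require Import all_boot all_order all_algebra.
From mathcomp Require Import mathcomp_extra boolp classical_sets.

Set Implicit Arguments.
Unset Strict Implicit.
Unset Printing Implicit Defensive.

Import Order.TTheory GRing.Theory Num.Theory.
Local Open Scope classical_set_scope.
Local Open Scope ring_scope.

(* The finite sums \sum_i a_i b_i with a_i in A and b_i in B; the empty sum is
   allowed. *)
Definition prod_set (R : comPzRingType) (A B : set R) : set R :=
  [set x | exists (k : nat) (a b : 'I_k -> R),
     [/\ forall i, A (a i), forall i, B (b i) & x = \sum_(i < k) a i * b i]].

Record strong_filtration (R : comPzRingType) (F : nat -> set R) : Prop :=
  StrongFiltration {
    filtration_subgroup : forall n, zmod_closed (mem (F n));
    filtration0 : F 0%N = setT;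
    filtrationS : forall n, F n.+1 `<=` F n;
    filtrationM : forall n m, prod_set (F n) (F m) = F (n + m)%N }.

(* A map K^* -> Z is represented by a function on K all of whose axioms are
   restricted to nonzero arguments: its value at 0 is arbitrary and is never
   used. *)
Record discrete_valuation (K : fieldType) := DiscreteValuation {
  valuation_fun :> K -> int;
  valuation_surj : forall n : int, exists2 a, a != 0 & valuation_fun a = n;
  valuationM : forall a b, a != 0 -> b != 0 ->
    valuation_fun (a * b) = valuation_fun a + valuation_fun b;
  valuationD : forall a b, a != 0 -> b != 0 -> a + b != 0 ->
    Num.min (valuation_fun a) (valuation_fun b) <= valuation_fun (a + b) }.

(* nu a >= n, with the convention nu 0 = oo. *)
Definition valuation_ge (K : fieldType) (nu : discrete_valuation K) (n : int) :
  {pred K} := [pred a | (a == 0) || (n <= nu a)].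

Definition in_dvr (K : fieldType) (nu : discrete_valuation K) : {pred K} :=
  valuation_ge nu 0.

Definition valuation_filtration (K : fieldType) (nu : discrete_valuation K)
  (n : nat) : set K := [set a | a \in valuation_ge nu n%:Z].

Section DVR.
Variables (K : fieldType) (nu : discrete_valuation K).

Lemma valuation1 : nu 1 = 0.
Proof.
have := valuationM nu (oner_neq0 K) (oner_neq0 K).
by rewrite mulr1 => /eqP; rewrite -subr_eq subrr eq_sym => /eqP.
Qed.

Lemma valuationN1 : nu (- 1) = 0.
Proof.
have N1 : - 1 != 0 :> K by rewrite oppr_eq0 oner_neq0.
have := valuationM nu N1 N1; rewrite mulrNN mulr1 valuation1 => /esym/eqP.
by rewrite -mulr2n mulrn_eq0 => /eqP.
Qed.

Fact in_dvr_subring : subring_closed (in_dvr nu).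
Proof.
have dM : {in in_dvr nu &, forall a b, a * b \in in_dvr nu}.
  move=> a b; rewrite !inE mulf_eq0.
  have [//|a0] := eqVneq a 0; have [//|b0] := eqVneq b 0.
  by rewrite /= valuationM //; apply: addr_ge0.
split=> //; first by rewrite inE valuation1 lexx orbT.
move=> a b aR bR.
have : - b \in in_dvr nu.
  by rewrite -mulN1r; apply: dM => //; rewrite inE valuationN1 lexx orbT.
move: (- b) aR => {bR}b; rewrite !inE.
have [->|a0] := eqVneq a 0; first by rewrite add0r.
have [->|b0] := eqVneq b 0; first by rewrite addr0 (negPf a0).
have [//|ab0] := eqVneq (a + b) 0 => /= av bv.
by apply: le_trans _ (valuationD nu a0 b0 ab0); rewrite le_min av bv.
Qed.

HB.instance Definition _ :=
  GRing.isSubringClosed.Build K (in_dvr nu) in_dvr_subring.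

Record dvr := Dvr { dvr_val :> K; _ : dvr_val \in in_dvr nu }.

HB.instance Definition _ := [isSub for dvr_val].
HB.instance Definition _ := [Choice of dvr by <:].
HB.instance Definition _ := [SubChoice_isSubComNzRing of dvr by <:].

End DVR.

(* Main.v *)
(** Surjectivity of the valuation provides, for each [n], some [a] with
    [nu a = n]; every [x] with [nu x >= n + m] then factors as
    [x = a * (x / a)], where [nu (x / a) >= m].  Thus a single product already
    gives the nontrivial inclusion of [R_(n + m)] in [R_n R_m]. *)
Require Import Defs.
From mathcomp Require Import all_boot all_order all_algebra.
From mathcomp Require Import mathcomp_extra boolp classical_sets.
Import Order.TTheory GRing.Theory Num.Theory.
Local Open Scope classical_set_scope.
Local Open Scope ring_scope.

Lemma valuation_geM (K : fieldType) (nu : discrete_valuation K) (n m : int)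
    (a b : K) :
  a \in valuation_ge nu n -> b \in valuation_ge nu m ->
  a * b \in valuation_ge nu (n + m).
Proof.
rewrite !inE mulf_eq0.
have [//|a0] := eqVneq a 0; have [//|b0] := eqVneq b 0 => /=.
by rewrite valuationM //; apply: lerD.
Qed.

Lemma valuation_geW (K : fieldType) (nu : discrete_valuation K) (n m : int)
    (a : K) :
  m <= n -> a \in valuation_ge nu n -> a \in valuation_ge nu m.
Proof.
move=> mn; rewrite !inE => /orP[->//|nua].
by rewrite (le_trans mn nua) orbT.
Qed.

Lemma valuation_ge_zmod_closed (K : fieldType) (nu : discrete_valuation K)
    (n : int) : zmod_closed (valuation_ge nu n).
Proof.
split=> [|a b an bn]; first by rewrite inE eqxx.
(* Since [-1] has valuation 0, [- b = -1 * b] stays at level [n], and only closure under addition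
   remains. *)
have : - b \in valuation_ge nu n.
  rewrite -mulN1r -(add0r n); apply: valuation_geM => //.
  by rewrite inE valuationN1 lexx orbT.
move: (- b) an => {bn}b; rewrite !inE.
(* [valuationD] applies only to nonzero [a], [b] and [a + b], so the zero cases are settled
   first. *)
have [->|a0] := eqVneq a 0; first by rewrite add0r.
have [->|b0] := eqVneq b 0; first by rewrite addr0 (negPf a0).
have [//|ab0] := eqVneq (a + b) 0 => /= av bv.
by apply: le_trans _ (valuationD nu a0 b0 ab0); rewrite le_min av bv.
Qed.

Lemma valuationV (K : fieldType) (nu : discrete_valuation K) (a : K) :
  a != 0 -> nu a^-1 = - nu a.
Proof.
move=> a0; apply/eqP; rewrite -addr_eq0 -valuationM ?invr_eq0 //.
by rewrite mulVf // valuation1.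
Qed.

Lemma valuation_ge_factor (K : fieldType) (nu : discrete_valuation K)
    (n m : int) (x : K) :
  x \in valuation_ge nu (n + m) ->
  exists a b, [/\ a \in valuation_ge nu n, b \in valuation_ge nu m & x = a * b].
Proof.
move=> xnm; have [a a0 an] := valuation_surj nu n.
exists a, (x / a); split; first by rewrite inE an lexx orbT.
(* [m] becomes [(n + m) - n], the sum of the bounds for [x] and [a^-1]. *)
- rewrite -[m](addKr n) addrC; apply: valuation_geM => //.
  by rewrite inE valuationV // an lexx orbT.
- by rewrite mulrCA divff // mulr1.
Qed.

(** The levels are subsets of [K], the filtration lives on [dvr nu]; the first conjunct ensures that
    pulling back along [val] loses no element. *)
Theorem proposition3p5 (K : fieldType) (nu : discrete_valuation K) :
  (forall n : nat, valuation_filtration nu n `<=` [set a | a \in in_dvr nu]) /\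
  strong_filtration
    (fun n : nat => [set x : dvr nu | valuation_filtration nu n (val x)]).
Proof.
have sub n : valuation_filtration nu n `<=` [set a | a \in in_dvr nu].
  by move=> a; apply: valuation_geW.
split=> //; split.
- move=> n; have [ge0 geB] := valuation_ge_zmod_closed K nu n%:Z.
  split=> [|x y /set_mem xn /set_mem yn]; apply/mem_set.
    by rewrite -(rmorph0 (val : dvr nu -> K)) in ge0.
  have := geB _ _ xn yn; by rewrite -(rmorphB (val : dvr nu -> K)).
- by apply/seteqP; split=> // x _; apply: valP.
- by move=> n x; apply: valuation_geW; rewrite lez_nat.
- move=> n m; apply/seteqP; split=> x.
  + case=> k [a [b [an bm ->]]].
    (* Exposing [val] lets the sum be moved into [K], where level [n + m] is closed under
       addition. *)
    change (val (\sum_(i < k) a i * b i) \in valuation_ge nu (n + m)%N%:Z).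
    rewrite rmorph_sum.
    have [ge0 geD] :=
      GRing.zmod_closedD (valuation_ge_zmod_closed K nu (n + m)%N%:Z).
    apply: (big_ind (fun z => z \in valuation_ge nu (n + m)%N%:Z)) => // i _.
    by rewrite rmorphM PoszD; apply: valuation_geM; [apply: an | apply: bm].
  + rewrite /valuation_filtration /= PoszD.
    move=> /valuation_ge_factor[a [b [an bm xab]]].
    (* The factors were found in [K]; as [n] and [m] are naturals, [sub] places them in the
       valuation ring. *)
    exists 1%N, (fun=> Dvr (sub n _ an)), (fun=> Dvr (sub m _ bm)).
    by split=> //; rewrite big_ord1; apply: val_inj; rewrite rmorphM.
Qed.
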